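(* Any homogeneous tetrahedron has $S\ge 2$ stable and $U\ge 2$ unstable equilibrium points (with respect to its center of mass).
   Context: A tetrahedron is the convex hull of four affinely independent points in $\mathbb{R}^3$; homogeneous means that its mass density is uniform, so its center of mass is its centroid. Equilibria: let $P$ be a convex polyhedron and $c\in\operatorname{int}P$. A point $q\in\operatorname{bd}P$ is an equilibrium point of $P$ with respect to $c$ if the plane $H$ through $q$ perpendicular to the segment $[c,q]$ supports $P$ at $q$. It is nondegenerate if $H\cap P$ is the (unique) face (of dimension 0, 1 or 2) of $P$ that contains $q$ in its relative interior. A nondegenerate equilibrium point is stable, saddle-type or unstable if $\dim(H\cap P)=2,1,0$, respectively. Only polyhedra all of whose equilibrium points with respect to the center of mass are nondegenerate are considered. *)

(* Defs.v *)
(* Euclidean 3-space is 'rV[R]_3 for R : realType. *)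
From HB Require Import structures.
From mathcomp Require Import all_boot all_order all_algebra.
From mathcomp Require Import all_classical all_reals all_analysis.

Set Implicit Arguments.
Unset Strict Implicit.
Unset Printing Implicit Defensive.

Import Order.TTheory GRing.Theory Num.Theory.
Import numFieldNormedType.Exports.

Local Open Scope classical_set_scope.
Local Open Scope ring_scope.

Section AffineGeometry.
Variable R : realType.
Implicit Types (A : set 'rV[R]_3).

Definition dotp (u v : 'rV[R]_3) : R := \sum_i u 0 i * v 0 i.

Definition conv_hull A : set 'rV[R]_3 :=
  smallest (fun C : set 'rV[R]_3 => convex_set C) A.

Definition aff_hull A : set 'rV[R]_3 :=
  [set x | exists n (a : 'I_n -> R) (p : 'I_n -> 'rV[R]_3),
     [/\ forall i, A (p i), \sum_i a i = 1 & x = \sum_i a i *: p i]].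

Definition affinely_independent n (p : 'I_n -> 'rV[R]_3) : Prop :=
  forall a : 'I_n -> R,
    \sum_i a i = 0 -> \sum_i a i *: p i = 0 -> forall i, a i = 0.

(* The affine hull of A has dimension d. *)
Definition has_dim A (d : nat) : Prop :=
  exists p : 'I_d.+1 -> 'rV[R]_3,
    [/\ affinely_independent p, range p `<=` A & A `<=` aff_hull (range p)].

Definition relint A : set 'rV[R]_3 :=
  [set x | A x /\ \forall y \near x, aff_hull A y -> A y].

Definition bd A : set 'rV[R]_3 := closure A `\` interior A.

Definition plane (q n : 'rV[R]_3) : set 'rV[R]_3 :=
  [set x | dotp (x - q) n = 0].

(* When n != 0: plane q n meets A at q and A lies on one side of it. *)
Definition supports_at (q n : 'rV[R]_3) A : Prop :=
  A q /\ ((forall x, A x -> dotp (x - q) n <= 0) \/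
          (forall x, A x -> 0 <= dotp (x - q) n)).

Definition proper_face (P F : set 'rV[R]_3) : Prop :=
  exists q n : 'rV[R]_3,
    [/\ n != 0, supports_at q n P & F = plane q n `&` P].

Definition tetrahedron (T : set 'rV[R]_3) : Prop :=
  exists p : 'I_4 -> 'rV[R]_3,
    affinely_independent p /\ T = conv_hull (range p).

End AffineGeometry.

Section CenterOfMass.
Variable R : realType.

(* The library has no Lebesgue measure on 'rV[R]_3: integrate over R * R * R. *)
Definition vec3 (x : R * R * R) : 'rV[R]_3 :=
  \row_(k < 3) [:: x.1.1; x.1.2; x.2]`_k.

Local Notation lambda := (@lebesgue_measure R).
Local Notation lambda3 := ((lambda \x lambda) \x lambda)%E.

Definition volume (P : set 'rV[R]_3) : \bar R := lambda3 (vec3 @^-1` P).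

(* Center of mass of a body P of uniform density, i.e. first moments divided
   by volume; the constant density cancels. *)
Definition center_of_mass (P : set 'rV[R]_3) : 'rV[R]_3 :=
  \row_(k < 3)
    ((\int[lambda3]_(x in vec3 @^-1` P) vec3 x 0 k) / fine (volume P)).

End CenterOfMass.

Section Equilibria.
Variable R : realType.
Implicit Types (P : set 'rV[R]_3) (c q : 'rV[R]_3).

Definition perp_plane c q : set 'rV[R]_3 := plane q (q - c).

Definition equilibrium P c q : Prop := bd P q /\ supports_at q (q - c) P.

Definition nondegenerate_at P c q : Prop :=
  proper_face P (perp_plane c q `&` P) /\ relint (perp_plane c q `&` P) q.

Definition nondeg_equilibrium_of_dim P c (d : nat) : set 'rV[R]_3 :=
  [set q | [/\ equilibrium P c q, nondegenerate_at P c q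
             & has_dim (perp_plane c q `&` P) d]].

Definition stable_equilibria P c := nondeg_equilibrium_of_dim P c 2.
Definition unstable_equilibria P c := nondeg_equilibrium_of_dim P c 0.

End Equilibria.

(* Main.v *)
(* Let b_i be the barycentric coordinates of the tetrahedron with vertices p_i, g its
   centroid and w_i the gradient of b_i.

   Center of mass: the sets {b_i > 1/2} are half-size copies of the tetrahedron (up to a null
   face), and what remains, the octahedron {all b_i <= 1/2}, is symmetric about g. Additivity
   gives M = M/4 + gV/4 + gV/2 for the first moment M and the volume V, so M = gV. Only the
   behaviour of Lebesgue measure under homotheties is needed.

   Equilibria: among four distinct vectors of sum 0, each of the two longest, say v, satisfies
   u.v < v.v for every other vector u of the family. Applied to p_i - g this makes the two
   vertices farthest from g unstable equilibria. Since b_i(x) = 1/4 + w_i.(x - g), the same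
   inequality for the w_i says that the foot of the perpendicular from g to the face
   {b_i = 0} lies inside that face, so the two faces nearest to g carry stable equilibria. *)
Require Import Defs.
From mathcomp Require Import all_boot all_order all_algebra.
From mathcomp Require Import all_classical all_reals all_analysis.
From mathcomp Require Import measurable_realfun ring lra.
Local Open Scope classical_set_scope.
Local Open Scope card_scope.

Set Implicit Arguments.
Unset Strict Implicit.
Unset Printing Implicit Defensive.

Import Order.TTheory GRing.Theory Num.Theory.
Import numFieldNormedType.Exports.

Local Open Scope ring_scope.

(** * Barycentric coordinates *)

Section Dotp.
Variable R : realType.
Implicit Types u v w : 'rV[R]_3.

Lemma dotpC u v : dotp u v = dotp v u.
Proof. by apply: eq_bigr => i _; rewrite mulrC. Qed.

Lemma dotpDl u v w : dotp (u + v) w = dotp u w + dotp v w.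
Proof. by rewrite -big_split; apply: eq_bigr => i _; rewrite mxE mulrDl. Qed.

Lemma dotpZl (a : R) u w : dotp (a *: u) w = a * dotp u w.
Proof. by rewrite mulr_sumr; apply: eq_bigr => i _; rewrite mxE mulrA. Qed.

Lemma dotpNl u w : dotp (- u) w = - dotp u w.
Proof. by rewrite -scaleN1r dotpZl mulN1r. Qed.

Lemma dotpBl u v w : dotp (u - v) w = dotp u w - dotp v w.
Proof. by rewrite dotpDl dotpNl. Qed.

Lemma dotp0l w : dotp 0 w = 0.
Proof. by rewrite -[0](scale0r 0) dotpZl mul0r. Qed.

Lemma dotp_suml (I : Type) (s : seq I) (P : pred I) (F : I -> 'rV[R]_3) w :
  dotp (\sum_(i <- s | P i) F i) w = \sum_(i <- s | P i) dotp (F i) w.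
Proof.
apply: (big_morph (fun u => dotp u w)) => [u v|]; [exact: dotpDl | exact: dotp0l].
Qed.

Lemma dotpDr u v w : dotp w (u + v) = dotp w u + dotp w v.
Proof. by rewrite !(dotpC w) dotpDl. Qed.

Lemma dotpBr u v w : dotp w (u - v) = dotp w u - dotp w v.
Proof. by rewrite !(dotpC w) dotpBl. Qed.

Lemma dotp_ge0 u : 0 <= dotp u u.
Proof. by apply: sumr_ge0 => i _; rewrite -expr2 sqr_ge0. Qed.

Lemma dotp_eq0 u : dotp u u = 0 -> u = 0.
Proof.
move/eqP; rewrite psumr_eq0 => [/allP u0|i _]; last by rewrite -expr2 sqr_ge0.
apply/rowP => i; rewrite mxE; apply/eqP; have := u0 i (mem_index_enum i).
by rewrite -expr2 sqrf_eq0.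
Qed.

Lemma dotp_gt0 u : u != 0 -> 0 < dotp u u.
Proof.
by move=> u0; rewrite lt0r dotp_ge0 andbT; apply: contra_neq u0; exact: dotp_eq0.
Qed.

End Dotp.

Section Barycentric.
Variable R : realType.

(** Gradient [w i] and constant term [c i] are kept separate because the gradients serve later as
    the normals of the faces. *)
Definition bary (w : 'I_4 -> 'rV[R]_3) (c : 'I_4 -> R) (i : 'I_4) (x : 'rV[R]_3) : R :=
  dotp x (w i) + c i.

Definition barycentric_coords (p w : 'I_4 -> 'rV[R]_3) (c : 'I_4 -> R) : Prop :=
  [/\ forall x, \sum_i bary w c i x = 1,
      forall x, \sum_i bary w c i x *: p i = x &
      forall i j, bary w c i (p j) = (i == j)%:R].

(** The vertices, each extended by a coordinate 1, are the rows of an invertible matrix [M]; the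
    columns of its inverse [N] hold the gradients and constants. *)
Lemma ex_barycentric_coords (p : 'I_4 -> 'rV[R]_3) :
  affinely_independent p -> exists w c, barycentric_coords p w c.
Proof.
move=> pind.
pose M : 'M[R]_4 := \matrix_(i, j) row_mx (p i) (1%:M : 'M[R]_1) 0 j.
have rowM i : row i M = row_mx (p i) 1%:M.
  by apply/rowP => j; rewrite !mxE.
have rowMl i (k : 'I_3) : row i M 0 (lshift 1 k) = p i 0 k.
  by rewrite rowM; exact: row_mxEl.
have rowMr i (k : 'I_1) : row i M 0 (rshift 3 k) = 1.
  by rewrite rowM; etransitivity; [exact: row_mxEr | rewrite mxE ord1].
(* A row vector in the kernel of [M] is an affine dependence among the [p i]. *)
have Mu : M \in unitmx.
  rewrite -row_free_unit -kermx_eq0; apply/rowV0P => v /sub_kermxP vM.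
  have {}vM : row_mx (\sum_i v 0 i *: p i) (\sum_i v 0 i)%:M = 0 :> 'M[R]_(1, 3 + 1).
    rewrite -vM [RHS]mulmx_sum_row.
    apply/rowP => j; rewrite [RHS]summxE.
    case: (split_ordP j) => k ->.
      rewrite row_mxEl summxE; apply: eq_bigr => i _.
      by rewrite mxE [RHS]mxE rowMl.
    rewrite row_mxEr mxE ord1 mulr1n; apply: eq_bigr => i _.
    by rewrite mxE rowMr mulr1.
  have := congr1 lsubmx vM; rewrite row_mxKl linear0 => v1.
  have := congr1 rsubmx vM; rewrite row_mxKr linear0 => v2.
  apply/rowP => i; rewrite [RHS]mxE; apply: (pind (fun i => v 0 i)) => //.
  by move/matrixP: v2 => /(_ 0 0); rewrite !mxE mulr1n.
pose N := invmx M.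
pose w (i : 'I_4) : 'rV[R]_3 := \row_k N (@lshift 3 1 k) i.
pose c (i : 'I_4) : R := N (@rshift 3 1 0) i.
have bE i x : bary w c i x = (row_mx x (1%:M : 'M[R]_1) *m N) 0 i.
  rewrite mxE [RHS](@big_split_ord _ _ _ 3 1) /= big_ord1 row_mxEr mxE mul1r; congr (_ + _).
  by apply: eq_bigr => k _; rewrite row_mxEl mxE.
(* This is [(x, 1) N M = (x, 1)]: the last column yields the sum 1, the other three recover [x]. *)
have bM x j : \sum_i bary w c i x * row i M 0 j = (row_mx x (1%:M : 'M[R]_1) : 'rV[R]_4) 0 j.
  rewrite -[in RHS](mulmxKV Mu (row_mx x (1%:M : 'M[R]_1))) [RHS]mxE.
  by apply: eq_bigr => i _; rewrite bE [row i M 0 j]mxE.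
exists w, c; split.
- move=> x; have := bM x (@rshift 3 1 0).
  rewrite [RHS](@row_mxEr _ 1 3 1) [RHS]mxE eqxx /= mulr1n => <-.
  by apply: eq_bigr => i _; rewrite rowMr mulr1.
- move=> x; apply/rowP => k; have := bM x (@lshift 3 1 k).
  rewrite [RHS](@row_mxEl _ 1 3 1) => <-; rewrite summxE.
  by apply: eq_bigr => i _; rewrite rowMl mxE.
- move=> i j; rewrite bE -rowM -row_mul mulmxV // !mxE.
  by rewrite eq_sym.
Qed.

End Barycentric.

Section Simplex.
Variable R : realType.
Variables (p w : 'I_4 -> 'rV[R]_3) (c : 'I_4 -> R).
Hypothesis pwc : barycentric_coords p w c.

Local Notation b := (bary w c).

Definition simplex : set 'rV[R]_3 := [set x | forall i, 0 <= b i x].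

Definition centroid : 'rV[R]_3 := 4^-1 *: \sum_i p i.

Lemma bary_line i s x y : b i ((1 - s) *: x + s *: y) = (1 - s) * b i x + s * b i y.
Proof. by rewrite /bary dotpDl !dotpZl; ring. Qed.

Lemma bary_sum (a : 'I_4 -> R) i : \sum_j a j = 1 -> b i (\sum_j a j *: p j) = a i.
Proof.
have [_ _ bp] := pwc => a1; rewrite /bary dotp_suml -[c i]mul1r -a1 mulr_suml -big_split /=.
rewrite (bigD1 i) //= big1 => [|j ji]; rewrite dotpZl -mulrDr -/(b i _) bp.
  by rewrite eqxx mulr1 addr0.
by rewrite eq_sym (negPf ji) mulr0.
Qed.

Lemma bary_centroid i : b i centroid = 4^-1.
Proof.
rewrite /centroid scaler_sumr (bary_sum (a := fun=> 4^-1)) //.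
by rewrite sumr_const card_ord -[_ *+ _]mulr_natr mulVf // pnatr_eq0.
Qed.

Lemma bary_le1 x i : simplex x -> b i x <= 1.
Proof.
move=> xT; have [b1 _ _] := pwc.
by rewrite -(b1 x) (bigD1 i) //= lerDl sumr_ge0.
Qed.

Lemma simplex_sum_le x (i j : 'I_4) : simplex x -> i != j -> b i x + b j x <= 1.
Proof.
move=> xT ij; have [b1 _ _] := pwc.
rewrite -(b1 x) (bigD1 i) //= (bigD1 j) 1?eq_sym //= addrA lerDl.
by apply: sumr_ge0 => k _; exact: xT.
Qed.

(** Boundedness of the simplex, the source of its finite volume and of the integrability of
    coordinates. *)
Lemma simplex_coord_le x k : simplex x -> `|x 0 k| <= \sum_i `|p i 0 k|.
Proof.
move=> xT; have [_ bp _] := pwc; rewrite -{1}(bp x) summxE.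
apply: le_trans (ler_norm_sum _ _ _) _; apply: ler_sum => i _.
by rewrite mxE normrM ler_piMl // ger0_norm ?xT // bary_le1.
Qed.

(** The simplex is convex and contains the vertices. Conversely a convex set is closed under
    combinations of any length, by induction from the two-point case. *)
Lemma conv_hull_simplex : conv_hull (range p) = simplex.
Proof.
have [b1 bp bd] := pwc; apply/seteqP; split=> x.
  apply; split; last by move=> _ [j _ <-] i; rewrite bd ler0n.
  move=> y z l; rewrite !inE => yT zT i.
  change (0 <= b i (l%:num *: (y : 'rV[R]_3) + (1 - l%:num) *: (z : 'rV[R]_3))).
  rewrite -{1}[l%:num](subKr 1).
  rewrite bary_line subKr addr_ge0 // mulr_ge0 // ?subr_ge0 //.
move=> xT C [Cconv Cp]; rewrite -(bp x).
have step : forall n (a : 'I_n -> R) (q : 'I_n -> 'rV[R]_3), (forall i, 0 <= a i) ->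
    \sum_i a i = 1 -> (forall i, C (q i)) -> C (\sum_i a i *: q i).
  elim=> [a q _|n IHn a q a0 a1 Cq].
    by rewrite big_ord0 => /eqP; rewrite eq_sym oner_eq0.
  rewrite big_ord_recl; have [a01|a01] := eqVneq (a ord0) 1.
    rewrite a01 scale1r big1 ?addr0 // => i _.
    have /eqP : \sum_(i < n) a (lift ord0 i) = 0 by move: a1; rewrite big_ord_recl a01; lra.
    rewrite psumr_eq0 // => /allP /(_ i (mem_index_enum i)) /eqP ->.
    by rewrite scale0r.
  (* The remaining weights have sum [t]; dividing by it gives a convex combination of [n] points. *)
  pose t := 1 - a ord0.
  have tE : \sum_(i < n) a (lift ord0 i) = t by rewrite /t; move: a1; rewrite big_ord_recl; lra.
  have t0 : 0 < t.
    by rewrite lt0r -{2}tE sumr_ge0 // andbT subr_eq0 eq_sym.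
  have Cs : C (\sum_(i < n) (t^-1 * a (lift ord0 i)) *: q (lift ord0 i)).
    apply: IHn => // [i|]; first by rewrite mulr_ge0 // invr_ge0 ltW.
    by rewrite -mulr_sumr tE mulVf // gt_eqF.
  have l01 : 0 <= a ord0 <= 1 by rewrite a0 -subr_ge0 -/t ltW.
  have := Cconv (q ord0) _ (Itv01 (andP l01).1 (andP l01).2) (mem_set (Cq ord0)) (mem_set Cs).
  rewrite inE; congr C; congr (_ + _); rewrite /= scaler_sumr; apply: eq_bigr => i _.
  by rewrite scalerA mulrA mulfV ?mul1r // gt_eqF.
apply: step => // i; exact/Cp/imageT.
Qed.

End Simplex.

(** * Long vectors in a family of four with sum zero *)

Section DominantVectors.
Variable R : realType.
Implicit Types u v : 'rV[R]_3.

(** Expand the squared length of [u - v], which is positive. *)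
Lemma dotp_lt_longest u v : u != v -> dotp u u <= dotp v v -> dotp u v < dotp v v.
Proof.
rewrite -subr_eq0 => /dotp_gt0; rewrite dotpBl !dotpBr (dotpC v u); lra.
Qed.

Lemma ord4_compl2 (i j : 'I_4) : i != j ->
  exists k l : 'I_4, [/\ k != i, k != j, l != i, l != j & k != l /\
    forall (V : zmodType) (F : 'I_4 -> V), \sum_m F m = F i + F j + F k + F l].
Proof.
move=> ij; have : #|~: [set i; j]| = 2.
  by have := cardsC [set i; j]; rewrite cards2 ij card_ord => /(@addnI 2 _ 2).
move/eqP/cards2P => [k [l [kl kl2]]]; exists k, l.
have [ki kj] : k != i /\ k != j.
  have : k \in ~: [set i; j] by rewrite kl2 !inE eqxx.
  by rewrite !inE negb_or => /andP.
have [li lj] : l != i /\ l != j.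
  have : l \in ~: [set i; j] by rewrite kl2 !inE eqxx orbT.
  by rewrite !inE negb_or => /andP.
split=> //; split=> // V F.
rewrite (bigD1 i) //= (bigD1 j) 1?eq_sym //= (bigD1 k) /= ?ki ?kj //.
rewrite (bigD1 l) /= ?li ?lj 1?eq_sym ?kl // big1 ?addr0 ?addrA //.
move=> m /andP[/andP[/andP[mi mj] mk] ml].
have : m \in ~: [set i; j] by rewrite !inE negb_or mi.
by rewrite kl2 !inE (negPf mk) (negPf ml).
Qed.

(* The two longest of the four vectors work: for the second longest [v j] against the
   longest [v i], substitute [v i = - v j - v k - v l]. *)
Lemma two_dominant_vectors (v : 'I_4 -> 'rV[R]_3) :
  injective v -> \sum_i v i = 0 ->
  exists i j, [/\ i != j,
    forall k, k != i -> dotp (v k) (v i) < dotp (v i) (v i) &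
    forall k, k != j -> dotp (v k) (v j) < dotp (v j) (v j)].
Proof.
move=> vinj v0.
have vneq i j : i != j -> v i != v j by rewrite (inj_eq vinj).
have [i _ imax] := @arg_maxP _ _ _ ord0 xpredT (fun i => dotp (v i) (v i)) isT.
have [j0 j0i] : exists j0, j0 != i by exists (lift i ord0); rewrite eq_sym neq_lift.
have [j ji jmax] := @arg_maxP _ _ _ j0 (fun j => j != i) (fun i => dotp (v i) (v i)) j0i.
exists i, j; split; first by rewrite eq_sym.
  by move=> k ki; apply: dotp_lt_longest; [exact: vneq | exact: imax].
move=> k kj; have [->|ki] := eqVneq k i; last first.
  by apply: dotp_lt_longest; [exact: vneq | exact: jmax].
have ij : i != j by rewrite eq_sym.
have [m [l [mi mj li lj [ml sumE]]]] := ord4_compl2 ij.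
(* Both bounds expand the squared length of [u + v j]; the inequality is strict unless
   [u = - v j]. *)
have ge u : dotp u u <= dotp (v j) (v j) -> u != - v j -> - dotp (v j) (v j) < dotp u (v j).
  rewrite -subr_eq0 opprK => + /dotp_gt0; rewrite dotpDl !dotpDr (dotpC (v j) u); lra.
have ge' u : dotp u u <= dotp (v j) (v j) -> - dotp (v j) (v j) <= dotp u (v j).
  by have := dotp_ge0 (u + v j); rewrite dotpDl !dotpDr (dotpC (v j) u); lra.
have : dotp (v i + v j + v m + v l) (v j) = 0 by rewrite -sumE v0 dotp0l.
rewrite !dotpDl => sum0.
have := ge' _ (jmax m mi); have := ge' _ (jmax l li).
(* By injectivity at most one of [v m] and [v l] equals [- v j], so one of the two bounds is strict,
   and [sum0] then bounds the product of [v i] and [v j]. *)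
have [mE|/(ge _ (jmax m mi))] := eqVneq (v m) (- v j); last by lra.
have /(ge _ (jmax l li)) : v l != - v j by rewrite -mE vneq // eq_sym.
lra.
Qed.

Lemma I2_card_le (T : pointedType) (A : set T) (x y : T) :
  A x -> A y -> x <> y -> `I_2 #<= A.
Proof.
move=> Ax Ay xy; apply/pcard_leP/injfunPex.
exists (fun n => if n == 0%N then x else y) => [[|[|//]] //|].
by move=> [|[|m]] [|[|n]]; rewrite !inE //= => _ _ // e; case: xy.
Qed.

End DominantVectors.

(** * Lebesgue measure under homotheties *)

(** The factor is that of preimages: a homothety of ratio [s] on the line has [k] equal to the
    inverse of [|s|]. *)
Definition scales_measure d (T : measurableType d) (R : realType)
    (m : set T -> \bar R) (f : T -> T) (k : R) : Prop :=
  forall A, measurable A -> m (f @^-1` A) = (k%:E * m A)%E.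

Section ScalesMeasure.
Context d (T : measurableType d) (R : realType) (m : {measure set T -> \bar R}).
Variables (f : T -> T) (k : R).
Hypotheses (mf : measurable_fun setT f) (k0 : 0 < k) (mfk : scales_measure m f k).

(** Change of variables: the pushforward of [m] under [f] is [k] times [m]. *)
Lemma ge0_integral_scales (D : set T) (g : T -> \bar R) :
  measurable D -> measurable_fun setT g -> (forall x, 0 <= g x)%E ->
  (\int[m]_(x in f @^-1` D) g (f x) = k%:E * \int[m]_(x in D) g x)%E.
Proof.
move=> mD mg g0; rewrite -(ge0_integral_pushforward mf) //; last exact: measurable_funTS.
rewrite [LHS](eq_measure_integral (mscale (NngNum (ltW k0)) m)); last first.
  by move=> A mA _; exact: (mfk mA).
by rewrite ge0_integral_mscale //; exact: measurable_funTS.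
Qed.

Lemma Rintegral_scales (D : set T) (g : T -> R) :
  measurable D -> measurable_fun setT g ->
  \int[m]_(x in f @^-1` D) g (f x) = k * \int[m]_(x in D) g x.
Proof.
move=> mD mg.
have mEg : measurable_fun setT (EFin \o g) by exact/measurable_EFinP.
set A := (\int[m]_(x in D) (EFin \o g)^\+ x)%E.
set B := (\int[m]_(x in D) (EFin \o g)^\- x)%E.
have A0 : (0 <= A)%E by exact: integral_ge0.
have B0 : (0 <= B)%E by exact: integral_ge0.
have -> : \int[m]_(x in f @^-1` D) g (f x) = fine (k%:E * A - k%:E * B)%E.
  rewrite /Rintegral integralE; congr (fine (_ - _)%E).
  - rewrite /A -(ge0_integral_scales (g := (EFin \o g)^\+%E)) //; last exact: measurable_funepos.
    by apply: eq_integral => x _; exact: (congr1 (@^~ x) (funepos_comp (EFin \o g) f)).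
  - rewrite /B -(ge0_integral_scales (g := (EFin \o g)^\-%E)) //; last exact: measurable_funeneg.
    by apply: eq_integral => x _; exact: (congr1 (@^~ x) (funeneg_comp (EFin \o g) f)).
have -> : \int[m]_(x in D) g x = fine (A - B)%E by rewrite /Rintegral integralE.
(* If [A] or [B] is infinite, [fine] returns 0 on both sides. *)
clearbody A B; case: A B A0 B0 => [x| |] [y| |] //= _ _;
  by rewrite ?gt0_muley ?lte_fin //= ?mulr0 ?mulrBr.
Qed.

End ScalesMeasure.

(** The product measure integrates the measures of sections, and the section at [x] of the preimage
    is the preimage under [f2] of the section at [f1 x]. *)
Lemma scales_product_measure d1 d2 (T1 : measurableType d1) (T2 : measurableType d2)
    (R : realType) (m1 : {measure set T1 -> \bar R})
    (m2 : {sigma_finite_measure set T2 -> \bar R})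
    (f1 : T1 -> T1) (f2 : T2 -> T2) (k1 k2 : R) :
  measurable_fun setT f1 -> 0 < k1 -> 0 < k2 ->
  scales_measure m1 f1 k1 -> scales_measure m2 f2 k2 ->
  scales_measure (m1 \x m2)%E (fun x => (f1 x.1, f2 x.2)) (k1 * k2).
Proof.
move=> mf1 k10 k20 m1f m2f A mA; rewrite /product_measure1 /=.
(* The whole space is written as a preimage to fit [ge0_integral_scales]. *)
transitivity (\int[m1]_(x in f1 @^-1` setT) (k2%:E * m2 (xsection A (f1 x))))%E.
  apply: eq_integral => x _; rewrite -m2f; last exact: measurable_xsection.
  by congr (m2 _); apply/seteqP; split=> y; rewrite /xsection /= !inE.
have mx := measurable_fun_xsection m2 mA.
rewrite (ge0_integral_scales mf1 k10 m1f (g := fun y => (k2%:E * m2 (xsection A y))%E)) //.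
- rewrite ge0_integralZl //; last by rewrite lee_fin ltW.
  by rewrite muleA -EFinM.
- exact: measurable_funeM.
- by move=> x; rewrite mule_ge0 // lee_fin ltW.
Qed.

(** Provides a bundled measure, the form in which uniqueness of Lebesgue measure is applied. *)
Lemma ex_scaled_pushforward d1 d2 (T1 : measurableType d1) (T2 : measurableType d2)
    (R : realType) (m : {measure set T1 -> \bar R}) (f : T1 -> T2) (k : R) :
  measurable_fun setT f -> 0 <= k ->
  exists mu : {measure set T2 -> \bar R}, forall A, mu A = (k%:E * m (f @^-1` A))%E.
Proof.
move=> mf k0; unshelve eexists.
  by unshelve refine (mscale (NngNum k0) (pushforward m f) : {measure set T2 -> \bar R}).
by [].
Qed.

Section AffineMaps.
Variable R : realType.

Local Notation lambda := (@lebesgue_measure R).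
Local Notation lambda3 := ((lambda \x lambda) \x lambda)%E.
Local Notation R1 := (measurableTypeR R).

Definition affine1 (a s x : R) : R := a + s * x.

Lemma measurable_affine1 (a s : R) : measurable_fun [set: R1] (affine1 a s : R1 -> R1).
Proof. by apply: measurable_funD => //; apply: measurable_funM. Qed.

Lemma preimage_affine1_oc (a s u v : R) : s != 0 ->
  affine1 a s @^-1` `]u, v] =
  [set` if 0 < s then `](u - a) / s, (v - a) / s] else `[(v - a) / s, (u - a) / s[].
Proof.
move=> s0; apply/seteqP; split=> x; case: ifPn => s1; rewrite /affine1 /= !in_itv /=.
- by rewrite ltr_pdivrMr // ler_pdivlMr // => /andP[? ?]; apply/andP; split; lra.
- have {}s1 : s < 0 by rewrite lt_neqAle s0 leNgt.
  by rewrite ler_ndivrMr // ltr_ndivlMr // => /andP[? ?]; apply/andP; split; lra.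
- by rewrite ltr_pdivrMr // ler_pdivlMr // => /andP[? ?]; apply/andP; split; lra.
- have {}s1 : s < 0 by rewrite lt_neqAle s0 leNgt.
  by rewrite ler_ndivrMr // ltr_ndivlMr // => /andP[? ?]; apply/andP; split; lra.
Qed.

(** The pushforward multiplied by [|s|] agrees with Lebesgue measure on half-open intervals, hence
    everywhere. For negative [s] the preimage is open at the other end, which leaves its length
    unchanged. *)
Lemma lebesgue_affine1 (a s : R) (s0 : s != 0) :
  scales_measure lambda (affine1 a s : R1 -> R1) `|s|^-1.
Proof.
move=> A mA.
have ns0 : 0 <= `|s| by [].
have mh := measurable_affine1 a s.
have [mu muE] := ex_scaled_pushforward lambda mh ns0.
have -> : lambda A = mu A.
  apply: lebesgue_measure_unique => // _ [[u v] _ <-] /=.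
  rewrite muE preimage_affine1_oc //; case: ifPn => s1;
    rewrite [LHS]lebesgue_measure_itv /= lte_fin
      [lambda _]lebesgue_measure_itv /= lte_fin.
    rewrite ltr_pM2r ?invr_gt0 // ltrD2r gtr0_norm //.
    by case: ifP => // _; rewrite ?mule0 // -!EFinB -EFinM; congr EFin; field.
  have {}s1 : s < 0 by rewrite lt_neqAle s0 leNgt.
  rewrite ltr_nM2r ?invr_lt0 // ltrD2r ltr0_norm //.
  by case: ifP => // _; rewrite ?mule0 // -!EFinB -EFinM; congr EFin; field.
by rewrite muE muleA -EFinM mulVf ?mul1e // normr_eq0.
Qed.

Definition affine3 (a : 'rV[R]_3) (s : R) (x : R * R * R) : R * R * R :=
  (affine1 (a 0 0) s x.1.1, affine1 (a 0 1) s x.1.2, affine1 (a 0 2%:R) s x.2).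

Lemma vec3_affine3 a s x : vec3 (affine3 a s x) = a + s *: vec3 x.
Proof.
apply/rowP => k; rewrite !mxE.
by case: k => -[|[|[|//]]] k /=; congr (a _ _ + _); apply: val_inj.
Qed.

Lemma measurable_affine3 a s :
   measurable_fun setT (affine3 a s : R1 * R1 * R1 -> R1 * R1 * R1).
Proof.
apply: measurable_fun_pair; last first.
  by apply: (measurableT_comp (measurable_affine1 _ _)).
apply: measurable_fun_pair; apply: (measurableT_comp (measurable_affine1 _ _)) => //;
  by apply: measurableT_comp.
Qed.

Lemma lebesgue_affine3 a (s : R) (s0 : s != 0) :
  scales_measure lambda3 (affine3 a s : R1 * R1 * R1 -> R1 * R1 * R1) (`|s|^-1 ^+ 3).
Proof.
have k0 : 0 < `|s|^-1 by rewrite invr_gt0 normr_gt0.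
have m1 := @measurable_affine1.
have H12 := scales_product_measure (m1 (a 0 0) s) k0 k0
  (lebesgue_affine1 (a 0 0) s0) (lebesgue_affine1 (a 0 1) s0).
rewrite exprSr expr2.
apply: (scales_product_measure _ _ k0 H12 (lebesgue_affine1 (a 0 2%:R) s0)).
  by apply: measurable_fun_pair; exact: (measurableT_comp (m1 _ _)).
by rewrite mulr_gt0.
Qed.

End AffineMaps.

(** * The center of mass of a tetrahedron *)

Section Measurability.
Variable R : realType.
Local Notation R1 := (measurableTypeR R).

Lemma measurable_vec3_coord (k : 'I_3) :
  measurable_fun setT (fun x : R1 * R1 * R1 => vec3 x 0 k : R1).
Proof.
have m1 : measurable_fun setT (fst : R1 * R1 * R1 -> _) by exact: measurable_fst.
case: k => -[|[|[|//]]] k; under eq_fun do rewrite mxE /=.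
- by apply: measurableT_comp.
- by apply: measurableT_comp.
- exact: measurable_snd.
Qed.

Lemma measurable_bary (w : 'I_4 -> 'rV[R]_3) (c : 'I_4 -> R) i :
  measurable_fun setT (fun x : R1 * R1 * R1 => bary w c i (vec3 x) : R1).
Proof.
apply: measurable_funD => //; under eq_fun do rewrite /dotp.
apply: measurable_sum => k; apply: measurable_funM => //.
exact: measurable_vec3_coord.
Qed.

Lemma measurable_le_set d (T : measurableType d) (f g : T -> R) :
  measurable_fun setT f -> measurable_fun setT g -> measurable [set x | f x <= g x].
Proof.
move=> mf mg; have := measurable_fun_ler mf mg measurableT (I : measurable [set true]).
by rewrite setTI.
Qed.

Lemma measurable_lt_set d (T : measurableType d) (f g : T -> R) :
  measurable_fun setT f -> measurable_fun setT g -> measurable [set x | f x < g x].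
Proof.
move=> mf mg; have := measurable_fun_ltr mf mg measurableT (I : measurable [set true]).
by rewrite setTI.
Qed.

Lemma measurable_simplex (w : 'I_4 -> 'rV[R]_3) (c : 'I_4 -> R) :
  measurable (@vec3 R @^-1` simplex w c : set (R1 * R1 * R1)).
Proof.
rewrite (_ : _ @^-1` _ = \bigcap_(i in [set: 'I_4]) [set x | 0 <= bary w c i (vec3 x)]).
  apply: fin_bigcap_measurable => // i _; apply: measurable_le_set => //.
  exact: measurable_bary.
by apply/seteqP; split=> x; [move=> xT i _; exact: xT | move=> xT i; exact: xT].
Qed.

Lemma measurable_bary_le (w : 'I_4 -> 'rV[R]_3) (c : 'I_4 -> R) (a : R) :
  measurable ([set x | forall i, bary w c i (vec3 x) <= a] : set (R1 * R1 * R1)).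
Proof.
rewrite (_ : [set _ | _] = \bigcap_(i in [set: 'I_4]) [set x | bary w c i (vec3 x) <= a]).
  apply: fin_bigcap_measurable => // i _; apply: measurable_le_set => //.
  exact: measurable_bary.
by apply/seteqP; split=> x; [move=> xT i _; exact: xT | move=> xT i; exact: xT].
Qed.

End Measurability.

(** * The volume of the simplex is finite and positive *)

Section SimplexVolume.
Variable R : realType.
Variables (p w : 'I_4 -> 'rV[R]_3) (c : 'I_4 -> R).
Hypothesis pwc : barycentric_coords p w c.

Local Notation b := (bary w c).
Local Notation lambda := (@lebesgue_measure R).
Local Notation lambda3 := ((lambda \x lambda) \x lambda)%E.
Local Notation R1 := (measurableTypeR R).
Local Notation R3 := (R1 * R1 * R1)%type.
Local Notation T := (simplex w c).
Local Notation E := (@vec3 R @^-1` T : set R3).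

Definition box (a : 'rV[R]_3) (r : R) : set R3 :=
  (`[a 0 0 - r, a 0 0 + r] `*` `[a 0 1 - r, a 0 1 + r]) `*` `[a 0 2%:R - r, a 0 2%:R + r].

Lemma boxP a r (x : R3) : box a r x <-> forall k, `|vec3 x 0 k - a 0 k| <= r.
Proof.
split=> [[[]]|H].
  rewrite /= !in_itv /= => h0 h1 h2.
  case=> -[|[|[|//]]] k; rewrite mxE /= ler_norml.
  - by move: h0; rewrite (_ : Ordinal k = 0) => [/andP[? ?]|];
      [apply/andP; split; lra | exact: val_inj].
  - by move: h1; rewrite (_ : Ordinal k = 1) => [/andP[? ?]|];
      [apply/andP; split; lra | exact: val_inj].
  - by move: h2; rewrite (_ : Ordinal k = 2%:R) => [/andP[? ?]|];
      [apply/andP; split; lra | exact: val_inj].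
have h0 := H 0; have h1 := H 1; have h2 := H 2%:R.
rewrite !mxE /= !ler_norml in h0 h1 h2.
by split; [split|]; rewrite /= in_itv /=; apply/andP; split;
  [move: h0|move: h0|move: h1|move: h1|move: h2|move: h2] => /andP[? ?]; lra.
Qed.

Lemma measurable_box a r : measurable (box a r).
Proof. by apply: measurableX => //; apply: measurableX. Qed.

Lemma volume_box a r : 0 < r -> lambda3 (box a r) = ((r *+ 2) ^+ 3)%:E.
Proof.
move=> r0.
have mi (u v : R) : measurable (`[u, v] : set R1) by [].
have itv u : lambda `[u - r, u + r] = (r *+ 2)%:E.
  rewrite lebesgue_measure_itv /= lte_fin ltrD2l gtrN //.
  by rewrite -EFinB; congr EFin; ring.
rewrite /box product_measure1E //; last exact: measurableX.
rewrite /= product_measure1E // /= !itv -!EFinM.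
by congr EFin; ring.
Qed.

Lemma simplex_volume_lty : (lambda3 E < +oo)%E.
Proof.
(* Half the side of a cube about the origin containing the simplex; the 1 makes it positive. *)
pose K := 1 + \sum_k \sum_i `|p i 0 k|.
have K0 : 0 < K by rewrite ltr_pwDl // sumr_ge0 // => k _; rewrite sumr_ge0.
apply: (@le_lt_trans _ _ (lambda3 (box 0 K))); last by rewrite volume_box // ltry.
apply: le_measure; rewrite ?inE; [exact: measurable_simplex|exact: measurable_box|].
move=> x xT; apply/boxP => k; rewrite [(0 : 'rV_3) 0 k]mxE subr0.
apply: le_trans (simplex_coord_le pwc k xT) _.
rewrite /K (bigD1 k) //= addrCA lerDl addr_ge0 // sumr_ge0 // => j _; exact: sumr_ge0.
Qed.

(** A small cube about the centroid lies in the simplex: each [b i] is 1/4 at the center and varies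
    by at most [K / (4 * K)] over the cube. *)
Lemma simplex_volume_gt0 : (0 < lambda3 E)%E.
Proof.
pose K := 1 + \sum_i \sum_k `|w i 0 k|.
have K0 : 0 < K by rewrite ltr_pwDl // sumr_ge0 // => k _; rewrite sumr_ge0.
have r0 : 0 < (4 * K)^-1 by rewrite invr_gt0 mulr_gt0.
apply: (@lt_le_trans _ _ (lambda3 (box (centroid p) (4 * K)^-1))).
  by rewrite volume_box // lte_fin exprn_gt0 // mulrn_wgt0.
apply: le_measure; rewrite ?inE; [exact: measurable_box|exact: measurable_simplex|].
move=> x /boxP xb i; set g := centroid p in xb.
have -> : b i (vec3 x) = 4^-1 + dotp (vec3 x - g) (w i).
  by rewrite -(bary_centroid pwc i) /bary dotpBl -/g; ring.
rewrite -lerBlDl sub0r lerNl.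
apply: le_trans (ler_norm _) _; rewrite normrN.
apply: le_trans (ler_norm_sum _ _ _) _.
apply: (@le_trans _ _ (\sum_k (4 * K)^-1 * `|w i 0 k|)).
  by apply: ler_sum => k _; rewrite normrM ler_wpM2r // !mxE; have := xb k; rewrite !mxE.
rewrite -mulr_sumr invfM -mulrA ler_piMr ?invr_ge0 // mulrC ler_pdivrMr // mul1r.
rewrite /K (bigD1 i) //= addrCA lerDl addr_ge0 // sumr_ge0 // => j _; exact: sumr_ge0.
Qed.

End SimplexVolume.

(** * Four corners, a symmetric core, and their moments *)

Section SimplexCentroid.
Variable R : realType.
Variables (p w : 'I_4 -> 'rV[R]_3) (c : 'I_4 -> R).
Hypothesis pwc : barycentric_coords p w c.

Local Notation b := (bary w c).
Local Notation lambda := (@lebesgue_measure R).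
Local Notation lambda3 := ((lambda \x lambda) \x lambda)%E.
Local Notation R1 := (measurableTypeR R).
Local Notation R3 := (R1 * R1 * R1)%type.
Local Notation T := (simplex w c).
Local Notation E := (@vec3 R @^-1` T : set R3).
Local Notation g := (centroid p).

Definition homothety (a : 'rV[R]_3) (s : R) : R3 -> R3 := affine3 ((1 - s) *: a) s.

Lemma vec3_homothety a s x k :
  vec3 (homothety a s x) 0 k = (1 - s) * a 0 k + s * vec3 x 0 k.
Proof. by rewrite vec3_affine3 !mxE. Qed.

Lemma bary_homothety i a s x :
  b i (vec3 (homothety a s x)) = (1 - s) * b i a + s * b i (vec3 x).
Proof. by rewrite vec3_affine3 bary_line. Qed.

(** Since [b i] is nonnegative on [E], the inequality means [b i = 0]. *)
Definition face i : set R3 := E `&` [set x | b i (vec3 x) <= 0].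

Lemma measurable_face i : measurable (face i).
Proof.
apply: measurableI; first exact: measurable_simplex.
by apply: measurable_le_set => //; exact: measurable_bary.
Qed.

Lemma simplex_volume_fin : lambda3 E \is a fin_num.
Proof. by rewrite ge0_fin_numE //; exact: (simplex_volume_lty pwc). Qed.

(* The face is disjoint from every copy of the simplex shrunk about the centroid. *)
Lemma face_null i : lambda3 (face i) = 0.
Proof.
have mE := measurable_simplex w c; have mF := measurable_face i.
have Ffin : lambda3 (face i) \is a fin_num.
  rewrite ge0_fin_numE //; apply: le_lt_trans (simplex_volume_lty pwc).
  by apply: le_measure; rewrite ?inE //; exact: subIsetl.
(* The preimage under ratio [s^-1] is the copy of [E] shrunk by [s], of volume [s ^+ 3] times that
   of [E]. *)
have shrink s : 0 < s -> s < 1 ->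
    fine (lambda3 (face i)) + s ^+ 3 * fine (lambda3 E) <= fine (lambda3 E).
  move=> s0 s1; have sv0 : s^-1 != 0 by rewrite invr_eq0 gt_eqF.
  have hE := lebesgue_affine3 ((1 - s^-1) *: g) sv0 mE.
  rewrite -/(homothety g s^-1) gtr0_norm ?invr_gt0 // invrK in hE.
  have mH : measurable (homothety g s^-1 @^-1` E).
    by rewrite -[X in measurable X]setTI; exact: measurable_affine3.
  have HE : homothety g s^-1 @^-1` E `<=` E `\` face i.
    (* Multiplying by [s] shows that [b j] is at least [(1 - s) / 4] on the shrunk copy. *)
    have key x j : T (vec3 (homothety g s^-1 x)) -> 0 < b j (vec3 x).
      move=> /(_ j); rewrite bary_homothety (bary_centroid pwc) => H.
      have : 0 <= s * ((1 - s^-1) / 4 + s^-1 * b j (vec3 x)) by rewrite mulr_ge0 // ltW.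
      rewrite mulrDr mulrA mulrA mulrBr !mulfV ?gt_eqF // mulr1 mul1r.
      by lra.
    move=> x xH; split; first by move=> j; apply/ltW/key.
    by case=> _ /=; rewrite leNgt (key x i xH).
  have dis : lambda3 (face i `|` homothety g s^-1 @^-1` E) =
      (lambda3 (face i) + lambda3 (homothety g s^-1 @^-1` E))%E.
    apply: measureU => //; rewrite -subset0 => x [xF /HE [_]]; exact.
  have le : (lambda3 (face i) + lambda3 (homothety g s^-1 @^-1` E) <= lambda3 E)%E.
    rewrite -dis; apply: le_measure; rewrite ?inE //; first exact: measurableU.
    by rewrite subUset; split; [exact: subIsetl | move=> x /HE []].
  move: le; rewrite hE -(fineK Ffin) -(fineK simplex_volume_fin) -EFinM -EFinD lee_fin.
  exact.
set f := fine (lambda3 (face i)) in shrink; set V := fine (lambda3 E) in shrink.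
have f0 : 0 <= f by exact: fine_ge0.
have V0 : 0 <= V by exact: fine_ge0.
suff : f <= 0 by move=> fle; rewrite -(fineK Ffin) -/f; congr EFin; lra.
rewrite leNgt; apply/negP => fgt.
(* With [s = 1 - e] and the bound [1 - 3 * e] for its cube, [shrink] gives [f <= 3 * e * V], whereas
   this [e] makes the right side less than [f / 2]. The summand [f] keeps the denominator
   positive. *)
pose e := f / (2 * (3 * V + f)).
have D0 : 0 < 3 * V + f by lra.
have eE : e * (3 * V + f) = f / 2 by rewrite /e; field; rewrite gt_eqF.
have e0 : 0 < e by rewrite divr_gt0 // mulr_gt0.
have e1 : e < 1.
  by rewrite ltr_pdivrMr ?mulr_gt0 //; lra.
clearbody e.
have := shrink (1 - e); rewrite subr_gt0 e1 gtrBl e0 => /(_ isT isT).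
have e3 : (1 - e) ^+ 3 >= 1 - 3 * e.
  rewrite -subr_ge0 (_ : _ - _ = e * e * (3 - e)); last by ring.
  by rewrite !mulr_ge0 //; lra.
have : (1 - 3 * e) * V <= (1 - e) ^+ 3 * V by rewrite ler_wpM2r.
have : 0 < e * f by rewrite mulr_gt0.
nra.
Qed.

(** Strict here and weak in [core], the inequalities make the five pieces pairwise disjoint. *)
Definition corner i : set R3 := E `&` [set x | 2^-1 < b i (vec3 x)].
Definition core : set R3 := E `&` [set x | forall i, b i (vec3 x) <= 2^-1].

Lemma measurable_corner i : measurable (corner i).
Proof.
apply: measurableI; first exact: measurable_simplex.
by apply: measurable_lt_set => //; exact: measurable_bary.
Qed.

Lemma measurable_core : measurable core.
Proof.
by apply: measurableI; [exact: measurable_simplex | exact: measurable_bary_le].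
Qed.

(** Doubling about [p i] turns [b j] into [2 * b j - (j == i)], so the strict bound 1/2 becomes
    strict positivity of [b i]; hence the face is removed. *)
Lemma corner_homothety i : corner i = homothety (p i) 2 @^-1` (E `\` face i).
Proof.
have [_ _ bp] := pwc.
apply/seteqP; split=> x.
  move=> [xT] /= xi; have key j : 0 <= b j (vec3 (homothety (p i) 2 x)) /\
      (j = i -> 0 < b j (vec3 (homothety (p i) 2 x))).
    rewrite bary_homothety bp; have := xT j.
    case: eqVneq => [->|/eqP ji] /=; rewrite ?mulr0n ?mulr1n; split=> //; move: xi => /=; lra.
  split; first by move=> j; case: (key j).
  by case=> _ /=; rewrite leNgt (key i).2.
move=> [xT] /= xF; have {}xF : 0 < b i (vec3 (homothety (p i) 2 x)).
  by rewrite ltNge; apply/negP => xle; apply: xF.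
have H j : 0 <= 2 * b j (vec3 x) - (j == i)%:R.
  by have := xT j; rewrite bary_homothety bp; lra.
split; last by move: xF; rewrite /= bary_homothety bp eqxx /= mulr1n; lra.
by move=> j; have := H j; case: (j == i) => /=; rewrite ?mulr0n ?mulr1n; lra.
Qed.

(** Reflection in the centroid turns [b j] into [2^-1 - b j], exchanging the two bounds that define
    the core. *)
Lemma core_homothety : core = homothety g (-1) @^-1` core.
Proof.
have bE j x : b j (vec3 (homothety g (-1) x)) = 2^-1 - b j (vec3 x).
  by rewrite bary_homothety (bary_centroid pwc); field.
by apply/seteqP; split=> x [xT] /= xc; split=> j /=; have := xT j; have := xc j;
  rewrite /= ?bE; lra.
Qed.

Lemma integrable_simplex (f : R3 -> R) (D : set R3) (M : R) :
  measurable_fun setT f -> (forall x, E x -> `|f x| <= M) ->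
  measurable D -> D `<=` E -> lambda3.-integrable D (EFin \o f).
Proof.
move=> mf fM mD DE; apply: (@integrableS _ _ _ _ E) => //; first exact: measurable_simplex.
apply: measurable_bounded_integrable => //; first exact: measurable_simplex.
- exact: (simplex_volume_lty pwc).
- exact: measurable_funTS.
by exists M; split; rewrite ?num_real // => x Mx y Ey; apply: le_trans (fM y Ey) (ltW Mx).
Qed.

Lemma Rintegral_simplex_split (f : R3 -> R) (M : R) :
  measurable_fun setT f -> (forall x, E x -> `|f x| <= M) ->
  \int[lambda3]_(x in E) f x =
    \sum_i \int[lambda3]_(x in corner i) f x + \int[lambda3]_(x in core) f x.
Proof.
move=> mf fM.
have mK i := measurable_corner i; have mC := measurable_core.
have KE i : corner i `<=` E by exact: subIsetl.
have CE : core `<=` E by exact: subIsetl.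
have int D := integrable_simplex (D := D) mf fM.
have KK i j : i != j -> corner i `&` corner j `<=` set0.
  move=> ij x [[xT xi] [_ xj]]; have := simplex_sum_le pwc xT ij.
  by move: xi xj => /=; lra.
have KC i : corner i `&` core `<=` set0.
  by move=> x [[_ xi] [_ /(_ i)]]; move: xi => /=; lra.
(* Nested to the right, so that [step] peels off one corner at a time. *)
have EE : E = corner 0 `|` (corner 1 `|` (corner 2%:R `|` (corner 3%:R `|` core))).
  apply/seteqP; split=> [x xT|x]; last by repeat (case; first by case); case.
  have [/forallP xc|] := boolP [forall i, b i (vec3 x) <= 2^-1].
    by do 4 right; split.
  rewrite negb_forall => /existsP[i]; rewrite -ltNge => xi.
  have {}xi : corner i x by [].
  move: i xi; case=> -[|[|[|[|//]]]] k.
  - by rewrite (_ : Ordinal k = 0) => [|]; [left | exact: val_inj].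
  - by rewrite (_ : Ordinal k = 1) => [|]; [right; left | exact: val_inj].
  - by rewrite (_ : Ordinal k = 2%:R) => [|]; [do 2 right; left | exact: val_inj].
  - by rewrite (_ : Ordinal k = 3%:R) => [|]; [do 3 right; left | exact: val_inj].
have step i (D : set R3) : measurable D -> D `<=` E -> corner i `&` D `<=` set0 ->
    \int[lambda3]_(x in corner i `|` D) f x =
    \int[lambda3]_(x in corner i) f x + \int[lambda3]_(x in D) f x.
  move=> mD DE dis; apply: Rintegral_setU => //; last exact/disj_setPS.
  by apply: int; [exact: measurableU | rewrite subUset].
have dU i (A B : set R3) : corner i `&` A `<=` set0 -> corner i `&` B `<=` set0 ->
    corner i `&` (A `|` B) `<=` set0.
  by move=> dA dB; rewrite setIUr subUset.
have mU i D (mD : measurable D) : measurable (corner i `|` D) by exact: measurableU.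
have sU i D (DE : D `<=` E) : corner i `|` D `<=` E by rewrite subUset.
rewrite {1}EE step; [|by do 3 apply: (mU _ _)|by do 3 apply: (sU _ _)
  |by do 3 (apply: (dU _ _ _); first exact: KK)].
rewrite step; [|by do 2 apply: (mU _ _)|by do 2 apply: (sU _ _)
  |by do 2 (apply: (dU _ _ _); first exact: KK)].
rewrite step; [|exact: mU|exact: sU|by apply: (dU _ _ _); first exact: KK].
rewrite step //.
rewrite !big_ord_recl big_ord0 addr0 -!addrA.
have -> : lift ord0 ord0 = 1 :> 'I_4 by exact: val_inj.
have -> : lift ord0 (lift ord0 ord0) = 2%:R :> 'I_4 by exact: val_inj.
by have -> : lift ord0 (lift ord0 (lift ord0 ord0)) = 3%:R :> 'I_4 by exact: val_inj.
Qed.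

(** The corner is the preimage of [E] without a face under a map of ratio 2, and that face is
    null. *)
Lemma Rintegral_corner i (f : R3 -> R) (M : R) :
  measurable_fun setT f -> (forall x, E x -> `|f x| <= M) ->
  \int[lambda3]_(x in corner i) f (homothety (p i) 2 x) = 8^-1 * \int[lambda3]_(x in E) f x.
Proof.
move=> mf fM; have mE := measurable_simplex w c; have mF := measurable_face i.
have mEF : measurable (E `\` face i) by exact: measurableD.
rewrite corner_homothety (Rintegral_scales _ _ (lebesgue_affine3 _ _)) //.
- rewrite gtr0_norm // (_ : 2^-1 ^+ 3 = 8^-1); last by field.
  congr (_ * fine _); symmetry; apply: negligible_integral => //; last exact: face_null.
  exact: (integrable_simplex mf fM).
- exact: measurable_affine3.
- by rewrite exprn_gt0 // invr_gt0 normr_gt0.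
Qed.

Lemma Rintegral_core (f : R3 -> R) : measurable_fun setT f ->
  \int[lambda3]_(x in core) f (homothety g (-1) x) = \int[lambda3]_(x in core) f x.
Proof.
move=> mf; rewrite {1}core_homothety (Rintegral_scales _ _ (lebesgue_affine3 _ _)) //.
- by rewrite normrN1 invr1 expr1n mul1r.
- exact: measurable_affine3.
- by rewrite normrN1 invr1 expr1n.
- exact: measurable_core.
Qed.

Lemma center_of_mass_simplex : center_of_mass T = g.
Proof.
apply/rowP => k; rewrite mxE /volume.
set V := fine _; set M := Rintegral _ _ _.
have V0 : 0 < V.
  by rewrite fine_gt0 // (simplex_volume_gt0 pwc) (simplex_volume_lty pwc).
have mk : measurable_fun setT (fun x : R3 => vec3 x 0 k : R) by exact: measurable_vec3_coord.
have mE := measurable_simplex w c; have mC := measurable_core.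
have CE : core `<=` E by exact: subIsetl.
pose B := \sum_i `|p i 0 k|.
have kB (x : R3) : E x -> `|vec3 x 0 k| <= B by exact: (simplex_coord_le pwc).
have intk D := integrable_simplex (D := D) mk kB.
have int1 (D : set R3) r : measurable D -> D `<=` E -> lambda3.-integrable D (EFin \o cst r).
  by move=> mD DE; apply: (@integrable_simplex _ _ `|r|).
have le1 (x : R3) : E x -> `|(cst 1 : R3 -> R) x| <= 1 by rewrite normr1.
pose VC := \int[lambda3]_(x in core) (1 : R); pose MC := \int[lambda3]_(x in core) vec3 x 0 k.
have VE : \int[lambda3]_(x in E) (1 : R) = V by rewrite Rintegral_cst // mul1r.
(* Four corners of volume [V / 8] each. *)
have volume_split : V = 2^-1 * V + VC.
  rewrite -{1}VE (Rintegral_simplex_split (f := cst 1) _ le1) //; congr (_ + _).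
  under eq_bigr => i _ do rewrite (@Rintegral_corner i (cst 1) 1) // VE.
  by rewrite sumr_const card_ord -mulr_natl; field.
have corner_moment i : \int[lambda3]_(x in corner i) vec3 x 0 k =
    16^-1 * M + 16^-1 * V * p i 0 k.
  (* Halving toward [p i] undoes the doubling, so [f] after the homothety is the [k]-th
     coordinate. *)
  pose f (y : R3) : R := 2^-1 * vec3 y 0 k + 2^-1 * p i 0 k.
  have mf : measurable_fun setT f.
    by apply: measurable_funD => //; apply: measurable_funM.
  have fM (x : R3) : E x -> `|f x| <= 2^-1 * B + `|2^-1 * p i 0 k|.
    move=> Ex; apply: le_trans (ler_normD _ _) _; rewrite lerD2r normrM gtr0_norm //.
    by rewrite ler_wpM2l // kB.
  transitivity (\int[lambda3]_(x in corner i) f (homothety (p i) 2 x)).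
    by apply: eq_Rintegral => x _; rewrite /f vec3_homothety; field.
  rewrite (Rintegral_corner i mf fM) /f RintegralD //; last 2 first.
  - apply: (integrable_simplex (M := 2^-1 * B)) => //; first exact: measurable_funM.
    by move=> x Ex; rewrite normrM gtr0_norm // ler_wpM2l // kB.
  - exact: int1.
  rewrite RintegralZl //; last exact: intk.
  by rewrite Rintegral_cst // -/M -/V; field.
have core_moment : MC = g 0 k * VC.
  (* The reflected coordinate; the factor 1 exposes the integrand of [VC] to [RintegralZl]. *)
  pose f (y : R3) : R := 2 * g 0 k * 1 - vec3 y 0 k.
  have mf : measurable_fun setT f by exact: measurable_funB.
  have : MC = 2 * g 0 k * VC - MC; last by lra.
  transitivity (\int[lambda3]_(x in core) f (homothety g (-1) x)).
    by apply: eq_Rintegral => x _; rewrite /f vec3_homothety; ring.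
  rewrite Rintegral_core // /f RintegralB //; [|exact: int1|exact: intk].
  by rewrite RintegralZl //; exact: int1.
have ME : M = 4^-1 * M + 4^-1 * V * g 0 k + MC.
  rewrite {1}/M (Rintegral_simplex_split mk kB); congr (_ + _).
  under eq_bigr => i _ do rewrite corner_moment.
  rewrite big_split /= sumr_const card_ord -mulr_natl -mulr_sumr.
  by rewrite [g 0 k]mxE summxE; field.
apply: (mulIf (lt0r_neq0 V0)); rewrite divfK ?lt0r_neq0 //.
have VC2 : VC = V / 2 by lra.
rewrite core_moment VC2 in ME.
lra.
Qed.

End SimplexCentroid.

(** * Equilibria *)

Section SimplexEquilibria.
Variable R : realType.
Variables (p w : 'I_4 -> 'rV[R]_3) (c : 'I_4 -> R).
Hypothesis pwc : barycentric_coords p w c.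

Local Notation b := (bary w c).
Local Notation T := (simplex w c).
Local Notation g := (centroid p).

Lemma baryB i x y : b i x - b i y = dotp (x - y) (w i).
Proof. by rewrite /bary dotpBl; ring. Qed.

Lemma vertex_inj : injective p.
Proof.
have [_ _ bp] := pwc => i j pij; apply/eqP; have := bp i i.
by rewrite {1}pij bp eqxx; case: eqP => // _ /eqP; rewrite eq_sym oner_eq0.
Qed.

(** From [p i] to [p j] the function [b i] drops by 1 while [b j] rises by 1, impossible with equal
    gradients. *)
Lemma gradient_inj : injective w.
Proof.
have [_ _ bp] := pwc => i j wij; apply/eqP; case: eqVneq => // ij; exfalso.
have := baryB i (p i) (p j); rewrite wij -baryB !bp !eqxx [j == i]eq_sym (negPf ij) /=.
lra.
Qed.

(** The sum of the [b i] is constant, so its gradient [s] satisfies [dotp s s = 0]. *)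
Lemma sum_gradient : \sum_i w i = 0.
Proof.
have [b1 _ _] := pwc; apply: dotp_eq0; set s := \sum_i w i.
have : \sum_i (b i s - b i 0) = 0 by rewrite sumrB !b1 subrr.
under eq_bigr do rewrite baryB subr0 dotpC.
by rewrite -dotp_suml.
Qed.

Lemma simplex_vertex i : T (p i).
Proof. by have [_ _ bp] := pwc => j; rewrite bp ler0n. Qed.

(** On the line from [p i] through [x], the coordinate [b i] becomes negative just beyond [x]. *)
Lemma bd_simplex i x : T x -> b i x = 0 -> bd T x.
Proof.
move=> xT bx; split; first exact: subset_closure.
have [_ _ bp] := pwc.
pose h (s : R) : 'rV[R]_3 := (1 - s) *: p i + s *: x.
have h1 : h 1 = x by rewrite /h subrr scale0r add0r scale1r.
have hc : continuous (h : R^o -> 'rV[R]_3).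
  move=> s; apply: cvgD; apply: cvgZr_tmp; last exact: cvg_id.
  by apply: cvgB; [exact: cvg_cst | exact: cvg_id].
rewrite /interior /= => nT.
have : \forall s \near (1 : R^o), T (h s) by apply: hc; rewrite h1.
case/nbhs_ballP => e /= e0 /(_ (1 + e / 2)) H.
have /H /(_ i) : ball (1 : R^o) e (1 + e / 2).
  by rewrite /ball /= opprD addrA subrr sub0r normrN gtr0_norm; lra.
by rewrite bary_line bp bx eqxx /= mulr1n; lra.
Qed.

(** Write [x - p i] as the combination of the [p k - p i] with weights [b k x]. For [k != i]
    dominance makes the product of [p k - p i] with [p i - g] negative, so the plane supports [T]
    and meets it only at [p i]. *)
Lemma dominant_vertex_unstable i :
  (forall k, k != i -> dotp (p k - g) (p i - g) < dotp (p i - g) (p i - g)) ->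
  (equilibrium T g (p i) -> nondegenerate_at T g (p i)) ->
  unstable_equilibria T g (p i).
Proof.
move=> idom nd; have [b1 bp bd_] := pwc.
have dotE x : dotp (x - p i) (p i - g) = \sum_k b k x * dotp (p k - p i) (p i - g).
  rewrite -{1}(bp x) -{1}[p i]scale1r -(b1 x) scaler_suml -sumrB dotp_suml.
  by apply: eq_bigr => k _; rewrite -scalerBr dotpZl.
have lt0 k : k != i -> dotp (p k - p i) (p i - g) < 0.
  move/idom; rewrite (_ : p k - p i = (p k - g) - (p i - g)) ?dotpBl ?subr_lt0 //.
  by rewrite opprB addrA subrK.
have term_le0 x k : T x -> b k x * dotp (p k - p i) (p i - g) <= 0.
  move=> xT; have [->|/lt0/ltW ?] := eqVneq k i; first by rewrite subrr dotp0l mulr0.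
  by rewrite mulr_ge0_le0.
have eq : equilibrium T g (p i).
  split.
    apply: (@bd_simplex (lift i ord0)); first exact: simplex_vertex.
    by rewrite bd_ eq_sym (negPf (neq_lift _ _)).
  split; first exact: simplex_vertex.
  by left=> x xT; rewrite dotE; apply: sumr_le0 => k _; exact: term_le0.
have planeE : perp_plane g (p i) `&` T = [set p i].
  apply/seteqP; split=> [x [+ xT]|_ ->]; last first.
    by split; [rewrite /perp_plane /plane /= subrr dotp0l | exact: simplex_vertex].
  rewrite /perp_plane /plane /= dotE => /eqP.
  rewrite -oppr_eq0 -sumrN psumr_eq0 => [/allP x0|k _]; last by rewrite oppr_ge0 term_le0.
  have bx k : k != i -> b k x = 0.
    move=> ki; apply/eqP; have := x0 k (mem_index_enum k).
    by rewrite oppr_eq0 mulf_eq0 [X in _ || X]lt_eqF ?orbF // lt0.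
  rewrite -(bp x) -[RHS]scale1r -(b1 x) scaler_suml; apply: eq_bigr => k _.
  by have [->//|/bx ->] := eqVneq k i; rewrite !scale0r.
split=> //; first exact: nd.
rewrite planeE; exists (fun=> p i); split.
- by move=> a; rewrite big_ord1 => a0 _ j; rewrite ord1.
- by move=> _ [j _ <-].
- move=> _ ->; exists 1%N, (fun=> 1), (fun=> p i); split; rewrite ?big_ord1 ?scale1r //.
  by move=> _; exists ord0.
Qed.

(** Foot of the perpendicular from [g] to the plane [b i = 0]: moving by [- t *: w i] lowers [b i]
    from 1/4 by [t * dotp (w i) (w i)]. *)
Definition face_foot i : 'rV[R]_3 := g - (4 * dotp (w i) (w i))^-1 *: w i.

Lemma bary_face_foot i j :
  b j (face_foot i) = 4^-1 - (4 * dotp (w i) (w i))^-1 * dotp (w j) (w i).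
Proof.
rewrite -(bary_centroid pwc j) -[LHS](subrK (b j g)) baryB /face_foot addrAC subrr add0r.
by rewrite dotpNl dotpZl (dotpC (w i)) addrC.
Qed.

Section DominantGradient.
Variable i : 'I_4.
Hypothesis idom : forall k, k != i -> dotp (w k) (w i) < dotp (w i) (w i).

Let wi0 : 0 < dotp (w i) (w i).
Proof.
apply: dotp_gt0; apply/eqP => wi.
have := idom (k := lift i ord0); rewrite wi !(dotpC _ 0) !dotp0l ltxx eq_sym neq_lift.
by move/(_ isT).
Qed.

Lemma bary_face_foot_self : b i (face_foot i) = 0.
Proof. by rewrite bary_face_foot; field; rewrite gt_eqF. Qed.

Lemma bary_face_foot_gt0 j : j != i -> 0 < b j (face_foot i).
Proof.
move=> /idom ji; rewrite bary_face_foot subr_gt0 invfM -mulrA gtr_pMr //.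
by rewrite mulrC ltr_pdivrMr // mul1r.
Qed.

(** As [q - g] is a negative multiple of [w i], the perpendicular plane at [q] is [b i = 0]. It
    supports [T] along the whole face, whose three vertices witness dimension 2. *)
Lemma dominant_gradient_stable :
  (equilibrium T g (face_foot i) -> nondegenerate_at T g (face_foot i)) ->
  stable_equilibria T g (face_foot i).
Proof.
move=> nd; have [b1 bp bd_] := pwc; set q := face_foot i.
have qT : T q.
  move=> j; have [->|/bary_face_foot_gt0/ltW//] := eqVneq j i.
  by rewrite bary_face_foot_self.
have dotE x : dotp (x - q) (q - g) = - (4 * dotp (w i) (w i))^-1 * b i x.
  rewrite {2}/q /face_foot addrAC subrr add0r dotpC dotpNl dotpZl dotpC -baryB.
  by rewrite bary_face_foot_self subr0 mulNr.
have t0 : 0 < (4 * dotp (w i) (w i))^-1 by rewrite invr_gt0 mulr_gt0.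
have eq : equilibrium T g q.
  split; first by apply: (bd_simplex qT bary_face_foot_self).
  split=> //; left=> x xT; rewrite dotE mulNr oppr_le0 mulr_ge0 //; exact: ltW.
have planeE x : (perp_plane g q `&` T) x <-> T x /\ b i x = 0.
  rewrite /perp_plane /plane /= dotE; split=> [[/eqP + xT]|[xT ->]]; last by rewrite mulr0.
  by rewrite mulf_eq0 oppr_eq0 gt_eqF //= => /eqP.
split=> //; first exact: nd.
exists (fun k => p (lift i k)); split.
- move=> a a0 ap k.
  (* Applying a barycentric coordinate to the dependence isolates [a k]; its constant term vanishes
     because the [a j] sum to 0. *)
  have : \sum_j a j * b (lift i k) (p (lift i j)) = 0.
    rewrite /bary; under eq_bigr do rewrite mulrDr -dotpZl.
    by rewrite big_split /= -dotp_suml ap dotp0l -mulr_suml a0 mul0r addr0.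
  rewrite (bigD1 k) //= bd_ eqxx mulr1 big1 ?addr0 // => j jk.
  by rewrite bd_ (inj_eq lift_inj) eq_sym (negPf jk) mulr0.
- move=> _ [k _ <-]; apply/planeE; split; first exact: simplex_vertex.
  by rewrite bd_ (negPf (neq_lift _ _)).
- move=> x /planeE [xT bx].
  exists 3%N, (fun k => b (lift i k) x), (fun k => p (lift i k)); split.
  + by move=> k; exists k.
  + by rewrite -(b1 x) (bigD1_ord i) //= bx add0r.
  + by rewrite -[LHS](bp x) (bigD1_ord i) //= bx scale0r add0r.
Qed.

End DominantGradient.

End SimplexEquilibria.

Theorem theorem4 (R : realType) (T : set 'rV[R]_3)
    (hT : tetrahedron T)
    (hnd : forall q : 'rV[R]_3,
       equilibrium T (center_of_mass T) q ->
       nondegenerate_at T (center_of_mass T) q) :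
  (`I_2 #<= stable_equilibria T (center_of_mass T)) /\
  (`I_2 #<= unstable_equilibria T (center_of_mass T)).
Proof.
have [p [pind TE]] := hT.
have [w [c pwc]] := ex_barycentric_coords pind.
rewrite (conv_hull_simplex pwc) in TE; rewrite {}TE in hnd *.
rewrite (center_of_mass_simplex pwc) in hnd *; split.
- have [i [j [ij idom jdom]]] := two_dominant_vectors (gradient_inj pwc) (sum_gradient pwc).
  apply: (I2_card_le (dominant_gradient_stable pwc idom (hnd _))
                     (dominant_gradient_stable pwc jdom (hnd _))) => e.
  (* The feet differ: [b j] is positive at the foot for [i] and zero at the foot for [j]. *)
  have := bary_face_foot_gt0 pwc idom (j := j); rewrite e bary_face_foot_self // ltxx.
  by rewrite eq_sym ij => /(_ isT).
- have vinj : injective (fun i => p i - centroid p).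
    by move=> i j /addIr; exact: (vertex_inj pwc).
  have v0 : \sum_i (p i - centroid p) = 0.
    by rewrite sumrB sumr_const card_ord /centroid -scaler_nat scalerA mulfV ?scale1r ?subrr //.
  have [i [j [ij idom jdom]]] := two_dominant_vectors vinj v0.
  apply: (I2_card_le (dominant_vertex_unstable pwc idom (hnd _))
                     (dominant_vertex_unstable pwc jdom (hnd _))) => /(vertex_inj pwc) e.
  by rewrite e eqxx in ij.
Qed.
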